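(* The set $W^*=\{q\in Q:X_q=1\}$ is (with probability one) an infinite random set of the form $\{\vec V_m:m\in\mathbb{N}\}$ where, writing $\vec V_0=(0,0)$, the increments $\{\vec V_m-\vec V_{m-1}:m\in\mathbb{N}\}$ are i.i.d. $Q$-valued random vectors with distribution $\pi$, i.e. $P_\infty(\vec V_m-\vec V_{m-1}=(-a,b))=\pi(-a,b)$ for $a,b\in\mathbb{N}$. Moreover, the components of $\vec V_1$ have infinite means (the absolute value of each component has infinite expectation).
   Context: $\mathbb{N}$ denotes the positive integers. $S_N(312)$ is the set of permutations $\sigma=\sigma_1\ldots\sigma_N$ of $1,\dots,N$ for which there are no indices $i_1<i_2<i_3$ with $\sigma_{i_1}>\sigma_{i_3}>\sigma_{i_2}$; $P_N$ is the uniform probability distribution on $S_N(312)$. $Q=\{(-i,j):i,j\in\mathbb{N}\}$, $W_N=[-N,-1]\times[1,N]$. For each $N$, $X^N_{(-i,j)}=1$ if $(-i,j)\in W_N$ and $\sigma_{N-i+1}=j$, and $X^N_{(-i,j)}=0$ otherwise, where $\sigma$ has distribution $P_N$. $\{X_q:q\in Q\}$ is the collection of $\{0,1\}$-valued random variables, with joint distribution $P_\infty$, such that for every finite $C\subset Q$, $\{X^N_q:q\in C\}$ converges in distribution to $\{X_q:q\in C\}$ as $N\to\infty$ (such a collection exists). For $a,b\in\mathbb{N}$, $\pi(-a,b)=\dfrac{C_{a-1}C_{b-1}}{4^{a+b-1}}$, where $C_n=\frac1{n+1}\binom{2n}{n}$ is the Catalan number; $\pi$ is a probability distribution on $Q$.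 *)

(* Defs.v *)
From HB Require Import structures.
From mathcomp Require Import all_boot all_order all_algebra all_fingroup.
From mathcomp Require Import finmap.
From mathcomp Require Import all_classical all_reals all_analysis.

Set Implicit Arguments.
Unset Strict Implicit.
Unset Printing Implicit Defensive.

Import Order.TTheory GRing.Theory Num.Theory.
Import numFieldNormedType.Exports.

Local Open Scope classical_set_scope.
Local Open Scope ring_scope.

(* Z^2 with the discrete sigma-algebra. *)
Definition lattice : Type := (int * int)%type.
HB.instance Definition _ := GRing.Zmodule.copy lattice (int * int)%type.
HB.instance Definition _ := isPointed.Build lattice 0.
HB.instance Definition _ := @isMeasurable.Build default_measure_display
  lattice discrete_measurable discrete_measurable0
  discrete_measurableC discrete_measurableU.

Definition Q : set lattice :=
  [set q | exists i j : nat, [/\ (0 < i)%N, (0 < j)%N & q = (- i%:Z, j%:Z)]].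

Definition avoids312 (N : nat) (s : 'S_N) : bool :=
  ~~ [exists i1 : 'I_N, exists i2 : 'I_N, exists i3 : 'I_N,
       [&& (i1 < i2)%N, (i2 < i3)%N, (s i3 < s i1)%N & (s i2 < s i3)%N]].

Definition S312 (N : nat) : {set 'S_N} := [set s | avoids312 s].

(* Expectation under P_N, the uniform distribution on S_N(312). *)
Definition expect312 (R : realType) (N : nat) (f : 'S_N -> R) : R :=
  (\sum_(s in S312 N) f s) / #|S312 N|%:R.

Definition window (N : nat) : pred lattice :=
  fun q => [&& - N%:Z <= q.1, q.1 <= -1, 1 <= q.2 & q.2 <= N%:Z].

(* 'S_N acts on {0, ..., N-1}, so position N - i + 1 and value j of the
   one-line word sigma_1 ... sigma_N are k.+1 and (s k).+1 for some k : 'I_N;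
   here q = (-i, j), so N - i + 1 is N + q.1 + 1. *)
Definition XN (N : nat) (s : 'S_N) (q : lattice) : bool :=
  window N q && [exists k : 'I_N,
    ((k.+1)%:Z == N%:Z + q.1 + 1) && (((s k).+1)%:Z == q.2)].

(* The state space {0,1}^C being finite and discrete, every function on it is
   bounded and continuous: convergence in distribution is tested against all
   functions f. *)
Definition limit_of_XN (R : realType) (d : measure_display)
    (T : measurableType d) (P : probability T R) (X : Q -> {RV P >-> bool}) :=
  forall (C : {fset Q}) (f : {ffun C -> bool} -> R),
    (expect312 (fun s : 'S_N => f [ffun q : C => XN s (val (val q))]))%:E
      @[N --> \oo] -->
    'E_P[fun w => f [ffun q : C => X (val q) w]]%E.

Definition Wstar (R : realType) (d : measure_display)
    (T : measurableType d) (P : probability T R) (X : Q -> {RV P >-> bool})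
    (w : T) : set lattice :=
  [set val q | q in [set q : Q | X q w = true]].

Definition catalan (R : realType) (n : nat) : R :=
  (n.+1%:R)^-1 * 'C(2 * n, n)%:R.

Definition step_law (R : realType) (a b : nat) : R :=
  catalan R a.-1 * catalan R b.-1 / 4 ^+ (a + b - 1)%N.

Definition mutually_independent (R : realType) (d d' : measure_display)
    (T : measurableType d) (T' : measurableType d') (P : probability T R)
    (I : choiceType) (D : set I) (Y : I -> T -> T') :=
  forall (J : {fset I}) (B : I -> set T'),
    [set` J] `<=` D -> (forall i, i \in J -> measurable (B i)) ->
    P (\bigcap_(i in [set` J]) Y i @^-1` B i) =
    (\prod_(i <- J) P (Y i @^-1` B i))%E.

(* Main.v *)
From HB Require Import structures.
Require Import Defs.
From mathcomp Require Import finmap.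
From mathcomp Require Import all_boot all_order all_algebra all_fingroup.
From mathcomp Require Import all_classical all_reals all_analysis.
From mathcomp Require Import measurable_realfun.
From mathcomp Require Import ring lra zify.

Set Implicit Arguments.
Unset Strict Implicit.
Unset Printing Implicit Defensive.

Import Order.TTheory GRing.Theory Num.Theory.
Import numFieldNormedType.Exports.
Local Open Scope nat_scope.

(** Number the points of the quadrant Q from 0: the pair (i, j) of naturals
    stands for (-(i+1), j+1), so that (0, 0) is the innermost point. Call
    (a, b) a corner of a 0/1 configuration if it is the only occupied point of
    the box [0, a] x [0, b].

    Everything follows from one decomposition. If a 312-avoiding permutation of
    size N has a corner at (a, b), the avoidance forces the one-line word to
    split into four consecutive pieces: an avoiding arrangement t of the b
    smallest values, an arrangement r of the next M values above b, the
    value b itself, and an arrangement u of the a largest values, where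
    N = b + M + 1 + a (all 0-based). Conversely any three avoiding words t, r, u
    glue to such a permutation, and seen from the corner the configuration of
    the permutation is that of r ([card_corner]). The case a = 0, where the
    corner is just the last letter, is the Catalan recursion, so that S_N(312)
    has C_N elements ([card_S312]). In general, since C_M / C_N tends to
    4^-(a+b+1), the limit process renews itself at a corner ([prob_renewal]): it
    has a corner at (a, b) with probability pi, and given this, the
    configuration translated to the corner is distributed as the original one.
    The pieces t and u lie far away from the box, hence almost surely all other
    points of the limit process are to the upper left of the corner
    ([prob_far]). Finally, a corner exists almost surely because the masses pi
    over the K x K box sum to (1 - u_K)^2, where u_K = binom(2K, K) / 4^K tends
    to 0 ([prob_no_corner]).

    Iterating, outside a null set every configuration that remains after
    finitely many corners has a unique corner, and W* is the set of the
    successive corners. A prescribed finite sequence of corners has probability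
    the product of its masses ([history_law]), which is the independence of the
    increments. The partial sums of the mean of either coordinate over the
    K x K box are K u_K (1 - u_K), of order sqrt K, whence the infinite means. *)

(** * Permutations as words on the natural numbers *)

(** Words are total functions on the naturals, so that positions can be
    shifted between permutations of different sizes without casts. *)
Definition word (N : nat) (s : 'S_N) (k : nat) : nat :=
  oapp (fun i : 'I_N => val (s i)) 0 (insub k).

Lemma wordE N (s : 'S_N) (i : 'I_N) : word s i = s i.
Proof. by rewrite /word valK. Qed.

Lemma word_lt N (s : 'S_N) k : k < N -> word s k < N.
Proof. by move=> kN; rewrite (wordE s (Ordinal kN)). Qed.

Lemma word_inj N (s : 'S_N) k l :
  k < N -> l < N -> word s k = word s l -> k = l.
Proof.
move=> kN lN; rewrite (wordE s (Ordinal kN)) (wordE s (Ordinal lN)).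
by move=> /val_inj /perm_inj [].
Qed.

Lemma eq_word N (s t : 'S_N) :
  (forall k, k < N -> word s k = word t k) -> s = t.
Proof.
by move=> st; apply/permP => i; apply: val_inj; rewrite /= -!wordE st.
Qed.

Lemma word_exists N (f : nat -> nat) :
    (forall k, k < N -> f k < N) ->
    (forall k l, k < N -> l < N -> f k = f l -> k = l) ->
  exists s : 'S_N, forall k, k < N -> word s k = f k.
Proof.
move=> fN finj.
pose g (i : 'I_N) : 'I_N := Ordinal (fN i (ltn_ord i)).
have ginj : injective g.
  by move=> i j /(congr1 val) /= /finj -/(_ (ltn_ord i) (ltn_ord j)) /val_inj.
exists (perm ginj) => k kN.
by rewrite (wordE _ (Ordinal kN)) permE.
Qed.

(** Pigeonhole: it identifies the sizes of blocks of positions with the sizes of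
    the blocks of values that they carry. *)
Lemma word_initial N (s : 'S_N) m t : m <= N -> t <= N ->
  (forall k, k < N -> (word s k < t) = (k < m)) -> m = t.
Proof.
move=> mN tN H.
have card_lt r : r <= N -> #|[set i : 'I_N | i < r]| = r.
  move=> rN; rewrite -sum1_card.
  under eq_bigl do rewrite inE.
  by rewrite (big_ord_narrow rN) sum1_card card_ord.
rewrite -[LHS]card_lt // -[RHS]card_lt // -(card_imset _ (@perm_inj _ s)).
congr #|pred_of_set _|; apply/setP => j; rewrite -(permKV s j).
rewrite (mem_imset _ _ (@perm_inj _ s)) !inE.
by rewrite -H // wordE.
Qed.

Lemma avoids312P N (s : 'S_N) :
  reflect (forall i j k, i < j -> j < k -> k < N ->
             word s j < word s k -> word s k < word s i -> False)
          (s \in S312 N).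
Proof.
rewrite inE; apply: (iffP idP) => [/existsP H i j k ij jk kN s1 s2|H].
  have jN : j < N by lia.
  have iN : i < N by lia.
  apply: H; exists (Ordinal iN).
  apply/existsP; exists (Ordinal jN); apply/existsP; exists (Ordinal kN).
  by rewrite -!wordE /= ij jk s1 s2.
apply/existsP => -[i /existsP[j /existsP[k /and4P[ij jk ki kj]]]].
by apply: (H i j k) => //; rewrite !wordE.
Qed.

(** * The decomposition of a 312-avoiding permutation at a corner *)

Definition cfg N (s : 'S_N) (i j : nat) : bool :=
  XN s (- (i.+1)%:Z, j.+1%:Z)%R.

Lemma cfgE N (s : 'S_N) i j : cfg s i j = (i < N) && (word s (N - i.+1) == j).
Proof.
rewrite /cfg /XN /window /=.
case: (ltnP i N) => iN /=; last first.
  by apply/negbTE/negP => /andP[/andP[? ?] _]; lia.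
have kN : N - i.+1 < N by lia.
apply/andP/eqP => [[_ /existsP[k /andP[/eqP k1 /eqP k2]]]|w].
  have -> : N - i.+1 = k by lia.
  by rewrite wordE; lia.
split.
  have := word_lt s kN; rewrite w => jN.
  by apply/andP; split; lia.
apply/existsP; exists (Ordinal kN); rewrite -wordE /= w.
by apply/andP; split; apply/eqP; lia.
Qed.

(** The event that (a, b) is the first renewal point can be read off the finite
    box spanned by (a, b), whereas being the point nearest to the origin in one
    coordinate cannot: this is what makes limits along finite windows
    applicable. *)
Definition corner (c : nat -> nat -> bool) (a b : nat) : bool :=
  c a b && [forall i : 'I_a.+1, forall j : 'I_b.+1,
              c i j ==> (val i == a) && (val j == b)].

(** The origin of the quadrant is moved to the occupied point (a, b); the
    innermost point of the new quadrant is (a+1, b+1). *)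
Definition translate (c : nat -> nat -> bool) (a b i j : nat) : bool :=
  c (a.+1 + i) (b.+1 + j).

Lemma cornerP (c : nat -> nat -> bool) a b :
  reflect (c a b /\ forall i j, i <= a -> j <= b -> c i j -> i = a /\ j = b)
          (corner c a b).
Proof.
apply: (iffP andP) => -[cab H]; split=> //.
  move=> i j ia jb cij.
  have := forallP (forallP H (Ordinal (ia : i < a.+1))) (Ordinal (jb : j < b.+1)).
  by rewrite /= cij /= => /andP[/eqP-> /eqP->].
apply/forallP => i; apply/forallP => j; apply/implyP => cij.
have [ia jb] := H i j (ltn_ord i) (ltn_ord j) cij.
by apply/andP; split; apply/eqP.
Qed.

(** The letter b at position p plays two roles. As the last letter of a possible
    pattern 312 it forbids a larger letter followed by a smaller one before p,
    so the values below b come first; as the middle letter it keeps the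
    letters before p below the letters after p, all of which exceed b, so the
    last a letters are the largest ones. *)
Lemma corner_blocks N (s : 'S_N) a b (p := N - a.+1) :
    s \in S312 N -> corner (cfg s) a b ->
  [/\ a + b < N, word s p = b,
      forall k, k < N -> (word s k < b) = (k < b)
    & forall k, k < N -> (word s k <= p) = (k <= p)].
Proof.
move=> /avoids312P av /cornerP[]; rewrite cfgE => /andP[aN /eqP wp] box.
have pE : p = N - a.+1 by [].
rewrite -/p in wp; clearbody p.
have pN : p < N by lia.
have after k : p < k -> k < N -> b < word s k.
  move=> pk kN; rewrite ltnNge; apply/negP => kb.
  have [] := box (N - k.+1) (word s k).
  - by lia.
  - by [].
  - by rewrite cfgE (_ : N - (N - k.+1).+1 = k) ?eqxx ?andbT; lia.
  by lia.
have neqb k : k < N -> k != p -> word s k != b.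
  move=> kN /eqP kp; apply/eqP => wk; apply: kp.
  by apply: (@word_inj _ s _ _ kN pN); rewrite wk.
have up k l : k < l -> l < p -> b < word s k -> b < word s l.
  move=> kl lp wk; case: (ltngtP b (word s l)) => [//|wl|wl].
    by exfalso; apply: (av k l p) => //; rewrite wp.
  by have := neqb l; rewrite -wl eqxx; lia.
(* m is the first position before p with a letter above b, or p itself *)
pose m := find (fun k => b <= word s k) (iota 0 p).
have mp : m <= p by rewrite -[leqRHS](size_iota 0 p) find_size.
have lt_m k : k < m -> word s k < b.
  move=> km; have := before_find 0 km; rewrite nth_iota; last by lia.
  by rewrite add0n leqNgt => /negbFE.
have ge_m k : m <= k -> k < N -> b <= word s k.
  move=> mk kN; case: (ltngtP k p) => [kp|kp|->]; last by rewrite wp.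
    have hs : has (fun k => b <= word s k) (iota 0 p).
      by rewrite has_find size_iota -/m; lia.
    have := nth_find 0 hs; rewrite -/m nth_iota; last by lia.
    rewrite add0n => wm.
    case: (ltngtP m k) mk => // [mk _|<- //].
    apply/ltnW/(up m) => //; rewrite ltn_neqAle eq_sym wm andbT.
    by apply: neqb; lia.
  by apply/ltnW/after.
have bN : b < N by rewrite -wp word_lt.
have mb : m = b.
  apply: (@word_initial N s) => //; [lia | lia |] => k kN.
  case: (ltnP k m) => km; first by rewrite lt_m.
  by apply/negbTE; rewrite -leqNgt ge_m.
have low k : k < N -> (word s k < b) = (k < b).
  move=> kN; case: (ltnP k b); rewrite -{1}mb => km; first by rewrite lt_m.
  by apply/negbTE; rewrite -leqNgt ge_m.
have sep k l : k <= p -> p < l -> l < N -> word s k < word s l.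
  move=> kp pl lN; have wl := after _ pl lN.
  case: (ltngtP k p) kp => // [kp _|-> _]; last by rewrite wp.
  case: (ltngtP (word s k) (word s l)) => // [wkl|wkl].
    by exfalso; apply: (av k p l); rewrite ?wp.
  by have := @word_inj _ s k l _ lN wkl; lia.
pose t := \max_(k < p.+1) (word s k).+1.
have le_t k : k <= p -> word s k < t.
  move=> kp; apply: (leq_bigmax (Ordinal (kp : k < p.+1))
    (F := fun k : 'I_p.+1 => (word s k).+1)).
have t_le l : p < l -> l < N -> t <= word s l.
  move=> pl lN; apply/bigmax_leqP => i _; apply: sep => //.
  by rewrite -ltnS.
have tN : t <= N.
  by apply/bigmax_leqP => i _; apply: word_lt; have := ltn_ord i; lia.
have tp : p.+1 = t.
  apply: (@word_initial N s) => // k kN; rewrite ltnS.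
  case: (leqP k p) => kp; first by rewrite le_t.
  by apply/negbTE; rewrite -leqNgt t_le.
split=> //; first by have := lt_m b; lia.
move=> k kN; case: (leqP k p) => kp; first by rewrite -ltnS tp le_t.
by apply/negbTE; rewrite -ltnNge tp t_le.
Qed.

(** The inverse construction: the blocks t, r and u become the bottom left, the
    middle and the top right block of a permutation of size b + M + 1 + a, with
    the letter b inserted just after the middle block. *)
Definition glue_fun (b M : nat) (t r u : nat -> nat) (k : nat) : nat :=
  if k < b then t k
  else if k < b + M then b.+1 + r (k - b)
  else if k == b + M then b
  else (b + M).+1 + u (k - (b + M).+1).

Lemma glue_exists a b M (t : 'S_b) (r : 'S_M) (u : 'S_a) :
  exists s : 'S_((b + M).+1 + a), forall k, k < (b + M).+1 + a ->
    word s k = glue_fun b M (word t) (word r) (word u) k.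
Proof.
have Ht := @word_lt _ t; have Hr := @word_lt _ r; have Hu := @word_lt _ u.
apply: word_exists => [k kN|k l kN lN]; rewrite /glue_fun.
  case: (ltnP k b) => k1; first by have := Ht _ k1; lia.
  case: (ltnP k (b + M)) => k2; first by have := Hr (k - b); lia.
  case: eqP => k3; first by lia.
  by have := Hu (k - (b + M).+1); lia.
have Hrk := Hr (k - b); have Hrl := Hr (l - b).
have Huk := Hu (k - (b + M).+1); have Hul := Hu (l - (b + M).+1).
case: (ltnP k b) => k1; [have := Ht _ k1 | ];
case: (ltnP l b) => l1; [have := Ht _ l1 | | have := Ht _ l1 |].
- by move=> _ _; exact: word_inj.
- by move=> ?; case: (ltnP l (b + M)) => l2; [|case: eqP => l3]; lia.
- by move=> ?; case: (ltnP k (b + M)) => k2; [|case: eqP => k3]; lia.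
case: (ltnP k (b + M)) => k2; case: (ltnP l (b + M)) => l2.
- by move=> E; have := @word_inj _ r (k - b) (l - b); lia.
- by case: eqP => l3; lia.
- by case: eqP => l3; lia.
case: eqP => k3; case: eqP => l3; try lia.
by move=> E; have := @word_inj _ u (k - (b + M).+1) (l - (b + M).+1); lia.
Qed.

Definition glue a b M (t : 'S_b) (r : 'S_M) (u : 'S_a) : 'S_((b + M).+1 + a) :=
  sval (cid (glue_exists t r u)).

Section Glue.
Variables (a b M : nat) (t : 'S_b) (r : 'S_M) (u : 'S_a).

Let glueE k : k < (b + M).+1 + a ->
  word (glue t r u) k = glue_fun b M (word t) (word r) (word u) k.
Proof. exact: (svalP (cid (glue_exists t r u))). Qed.

Lemma glue_low k : k < b -> word (glue t r u) k = word t k.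
Proof. by move=> kb; rewrite glueE /glue_fun ?kb //; lia. Qed.

Lemma glue_mid k : k < M -> word (glue t r u) (b + k) = b.+1 + word r k.
Proof.
move=> kM; rewrite glueE /glue_fun; last by lia.
by rewrite ltnNge leq_addr /= ltn_add2l kM addKn.
Qed.

Lemma glue_corner_val : word (glue t r u) (b + M) = b.
Proof.
rewrite glueE /glue_fun; last by lia.
by rewrite ltnNge leq_addr /= ltnn eqxx.
Qed.

Lemma glue_high k : k < a ->
  word (glue t r u) ((b + M).+1 + k) = (b + M).+1 + word u k.
Proof.
move=> ka; rewrite glueE /glue_fun; last by lia.
by rewrite !ifF ?addKn //; lia.
Qed.

Lemma glue_cases k : k < (b + M).+1 + a ->
  [\/ k < b /\ word (glue t r u) k = word t k /\ word t k < b,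
      b <= k < b + M /\ word (glue t r u) k = b.+1 + word r (k - b)
        /\ word r (k - b) < M,
      k = b + M /\ word (glue t r u) k = b |
      b + M < k /\ word (glue t r u) k = (b + M).+1 + word u (k - (b + M).+1)
        /\ word u (k - (b + M).+1) < a].
Proof.
move=> kN; case: (ltnP k b) => kb.
  by constructor 1; rewrite glue_low ?word_lt.
case: (ltngtP k (b + M)) => kM.
- constructor 2; have k' : k - b < M by lia.
  have := glue_mid k'; rewrite (subnKC kb) => ->.
  by rewrite word_lt // andbT; split; lia.
- constructor 4; have k' : k - (b + M).+1 < a by lia.
  by have := glue_high k'; rewrite (subnKC kM) => ->; rewrite word_lt.
- by constructor 3; rewrite kM glue_corner_val.
Qed.

(** Cut the word into t, then r followed by b, then u: the values increase from
    one block to the next, while the first letter of a pattern 312 is its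
    largest, so the pattern lies inside one block. The letter b, last and least
    in its block, belongs to no such pattern. *)
Lemma glue_S312 : t \in S312 b -> r \in S312 M -> u \in S312 a ->
  glue t r u \in S312 ((b + M).+1 + a).
Proof.
move=> /avoids312P tA /avoids312P rA /avoids312P uA.
apply/avoids312P => i j k ij jk kN.
have iN : i < (b + M).+1 + a by lia.
have jN : j < (b + M).+1 + a by lia.
have Ht := tA i j k; have Hr := rA (i - b) (j - b) (k - b).
have Hu := uA (i - (b + M).+1) (j - (b + M).+1) (k - (b + M).+1).
case: (glue_cases iN) => [[i1 [-> i2]]|[i1 [-> i2]]|[i1 ->]|[i1 [-> i2]]];
case: (glue_cases jN) => [[j1 [-> j2]]|[j1 [-> j2]]|[j1 ->]|[j1 [-> j2]]]; try lia;
case: (glue_cases kN) => [[k1 [-> k2]]|[k1 [-> k2]]|[k1 ->]|[k1 [-> k2]]]; lia.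
Qed.

Lemma glue_corner : corner (cfg (glue t r u)) a b.
Proof.
apply/cornerP; rewrite cfgE; split.
  rewrite (_ : _ - _ = b + M); last by lia.
  by rewrite glue_corner_val eqxx andbT; lia.
move=> i j ia jb; rewrite cfgE => /andP[iN /eqP].
have kN : (b + M).+1 + a - i.+1 < (b + M).+1 + a by lia.
by case: (glue_cases kN) => [[k1 [-> k2]]|[k1 [-> k2]]|[k1 ->]|[k1 [-> k2]]]; lia.
Qed.

Lemma glue_translate : translate (cfg (glue t r u)) a b = cfg r.
Proof.
apply/funext => i; apply/funext => j; rewrite /translate !cfgE.
case: (ltnP i M) => iM /=.
  rewrite (_ : _ - _ = b + (M - i.+1)); last by lia.
  rewrite glue_mid; last by lia.
  by rewrite eqn_add2l andbC; case: eqP => //=; lia.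
apply/negbTE/negP => /andP[iN /eqP].
have kN : (b + M).+1 + a - (a.+1 + i).+1 < (b + M).+1 + a by lia.
by case: (glue_cases kN) => [[k1 [-> k2]]|[k1 [-> k2]]|[k1 ->]|[k1 [-> k2]]]; lia.
Qed.
End Glue.

Lemma glue_inj a b M (t t' : 'S_b) (r r' : 'S_M) (u u' : 'S_a) :
  glue t r u = glue t' r' u' -> [/\ t = t', r = r' & u = u'].
Proof.
move=> E; split; apply: eq_word => k kN.
- by rewrite -(glue_low t r u kN) E glue_low.
- by apply: (@addnI b.+1); rewrite -(glue_mid t r u kN) E glue_mid.
- by apply: (@addnI (b + M).+1); rewrite -(glue_high t r u kN) E glue_high.
Qed.

(** For cutting the three blocks out of a permutation with a corner. *)
Lemma restrict_word N (s : 'S_N) p v n :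
    p + n <= N -> (forall k, k < n -> v <= word s (p + k) < v + n) ->
    s \in S312 N ->
  exists2 t : 'S_n, t \in S312 n & forall k, k < n -> word s (p + k) = v + word t k.
Proof.
move=> pn H /avoids312P sA.
have [|k l kn ln E|t tE] := @word_exists n (fun k => word s (p + k) - v).
- by move=> k /H; lia.
- have := @word_inj _ s (p + k) (p + l); have := H _ kn; have := H _ ln; lia.
have sE k : k < n -> word s (p + k) = v + word t k.
  by move=> kn; rewrite tE //; have := H _ kn; lia.
exists t => //; apply/avoids312P => i j k ij jk kn w1 w2.
by apply: (sA (p + i) (p + j) (p + k)); rewrite ?sE; lia.
Qed.

Lemma glue_surj a b M (s : 'S_((b + M).+1 + a)) :
    s \in S312 _ -> corner (cfg s) a b ->
  exists t r u, [/\ t \in S312 b, r \in S312 M, u \in S312 a & s = glue t r u].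
Proof.
move=> sA sc; have [_] := corner_blocks sA sc.
rewrite (_ : _ - _ = b + M); last by lia.
move=> sb low high.
have [|k kb|t tA tE] := @restrict_word _ s 0 0 b _ _ sA; first by lia.
  by rewrite !add0n leq0n low; lia.
have [|k kM|r rA rE] := @restrict_word _ s b b.+1 M _ _ sA; first by lia.
  have := low (b + k); have := high (b + k).
  have := @word_inj _ s (b + k) (b + M).
  by lia.
have [|k ka|u uA uE] := @restrict_word _ s (b + M).+1 (b + M).+1 a _ _ sA;
  first by lia.
  have := high ((b + M).+1 + k); have := @word_lt _ s ((b + M).+1 + k).
  by lia.
exists t, r, u; split => //; apply: eq_word => k kN.
have [[k1 [-> _]]|[k1 [-> _]]|[k1 ->]|[k1 [-> _]]] := glue_cases t r u kN.
- by rewrite -[LHS]/(word s (0 + k)) tE.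
- by rewrite -rE; [congr (word s); lia | lia].
- by rewrite k1.
- by rewrite -uE; [congr (word s); lia | lia].
Qed.

(** Gluing is a bijection under which the permutation seen from its corner is the
    middle block. This one count yields both the Catalan recursion and the
    renewal property. *)
Lemma card_corner a b M N (g : (nat -> nat -> bool) -> bool) :
    N = (b + M).+1 + a ->
  #|[set s in S312 N | corner (cfg s) a b && g (translate (cfg s) a b)]| =
  #|S312 a| * #|S312 b| * #|[set r in S312 M | g (cfg r)]|.
Proof.
move=> ->{N}.
pose G (x : 'S_a * 'S_b * 'S_M) := glue x.1.2 x.2 x.1.1.
have Ginj : injective G.
  by move=> [[u t] r] [[u' t'] r'] /glue_inj /= [-> -> ->].
rewrite -!cardsX -(card_imset _ Ginj); congr #|pred_of_set _|.
apply/setP => s; apply/idP/imsetP => [|[[[u t] r]]].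
  rewrite inE => /and3P[sA sc sg].
  have [t [r [u [tA rA uA sE]]]] := glue_surj sA sc.
  exists (u, t, r) => //; rewrite !inE.
  move: sg; rewrite sE glue_translate => ->.
  by rewrite !inE in tA rA uA *; rewrite tA rA uA.
rewrite !finset.in_setX /= => /andP[/andP[uA tA]]; rewrite inE => /andP[rA rg ->].
by rewrite inE glue_S312 //= glue_corner /= glue_translate.
Qed.

(** A point that is not to the upper left of the corner belongs to the bottom
    left or the top right block, whose points have one coordinate close to N. *)
Lemma points_beyond_corner N (s : 'S_N) a b i j :
  s \in S312 N -> corner (cfg s) a b ->
  cfg s i j -> i + b < N -> j + a < N ->
  i = a /\ j = b \/ a < i /\ b < j.
Proof.
move=> sA sc; have [abN sb low high] := corner_blocks sA sc.
rewrite cfgE => /andP[iN /eqP wj] iN' jN'.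
have kN : N - i.+1 < N by lia.
have := low _ kN; have := high _ kN; rewrite wj => kh kl.
have [kp|kp] := eqVneq (N - i.+1) (N - a.+1); first by left; rewrite -wj kp sb; lia.
have jb : j <> b.
  by rewrite -wj -sb => /word_inj E; move/eqP: kp; apply; apply: E; lia.
lia.
Qed.

Lemma card_S312_0 : #|S312 0| = 1.
Proof.
have -> : S312 0 = [set: 'S_0].
  by apply/setP => s; rewrite finset.in_setT; apply/avoids312P.
by rewrite finset.cardsT card_Sn.
Qed.

(** Classify by the last letter, which is a corner in row a = 0. *)
Lemma card_S312_rec N :
  #|S312 N.+1| = \sum_(j < N.+1) #|S312 j| * #|S312 (N - j)|.
Proof.
rewrite -sum1_card (partition_big (fun s : 'S_N.+1 => s ord_max) predT) //=.
apply: eq_bigr => j _.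
have H : N.+1 = (j + (N - j)).+1 + 0 by have := ltn_ord j; lia.
have := card_corner predT H; rewrite card_S312_0 mul1n.
have -> : [set r in S312 (N - j) | predT (cfg r)] = S312 (N - j).
  by apply/setP => s; rewrite !inE andbT.
move=> <-; rewrite -sum1_card; apply: eq_bigl => s.
rewrite !inE /= andbT; congr andb.
apply/eqP/cornerP.
  move=> sj; rewrite cfgE subn1 /=.
  rewrite (wordE s ord_max) sj; split=> // i k.
  rewrite leqn0 => /eqP-> _; rewrite cfgE subn1 /= (wordE s ord_max) sj.
  by move/eqP.
by case; rewrite cfgE subn1 /= (wordE s ord_max) => /eqP sj _; exact: val_inj.
Qed.

Local Open Scope classical_set_scope.
Local Open Scope ring_scope.

(** * Catalan numbers *)

Section Catalan.
Variable R : realType.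
Local Notation cat := (catalan R).

(** The probability that simple random walk is back at 0 after 2n steps; all
    partial sums below have closed forms in terms of it. *)
Definition central (n : nat) : R := 'C(2 * n, n)%:R / 4 ^+ n.

Lemma bin_central n : (n.+1 * 'C(2 * n.+1, n.+1) = 2 * (2 * n).+1 * 'C(2 * n, n))%N.
Proof.
have E : (2 * n.+1 = (2 * n).+2)%N by lia.
rewrite E -mul_bin_diag /=.
have := mul_bin_down (2 * n).+1 n.
rewrite /= (_ : ((2 * n).+1 - n = n.+1)%N); last by lia.
nia.
Qed.

Lemma catalan0 : cat 0 = 1.
Proof. by rewrite /catalan bin0 invr1 mulr1. Qed.

Lemma catalanE n : n.+1%:R * cat n = 'C(2 * n, n)%:R :> R.
Proof. by rewrite /catalan mulrA mulfV ?mul1r // pnatr_eq0. Qed.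

Lemma catalanS n : n.+2%:R * cat n.+1 = (4 * n + 2)%:R * cat n.
Proof.
have n1 : n.+1%:R != 0 :> R by rewrite pnatr_eq0.
apply: (mulfI n1); rewrite catalanE -natrM bin_central [RHS]mulrCA catalanE -natrM.
by congr (_%:R); lia.
Qed.

Lemma catalan_gt0 n : 0 < cat n.
Proof.
by rewrite /catalan mulr_gt0 ?invr_gt0 ?ltr0n // bin_gt0; lia.
Qed.

(** The classical recursion is derived from the ratio of consecutive terms. With
    S_n the convolution and T_n the sum weighted by i, the reflection
    i -> n - i gives 2 T_n = n S_n, while the ratio gives
    T_(n+1) + S_(n+1) = C_(n+1) + 4 T_n + 2 S_n; eliminating T determines
    S_(n+1) from S_n. *)
Lemma catalan_conv n : \sum_(i < n.+1) cat i * cat (n - i)%N = cat n.+1.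
Proof.
pose S m : R := \sum_(i < m.+1) cat i * cat (m - i)%N.
pose T m : R := \sum_(i < m.+1) i%:R * (cat i * cat (m - i)%N).
have ST m : T m *+ 2 = m%:R * S m.
  rewrite mulr2n {2}/T (reindex_inj rev_ord_inj) -big_split /S mulr_sumr /=.
  apply: eq_bigr => i _; rewrite subSS subKn; last by rewrite -ltnS.
  have im : (i <= m)%N by rewrite -ltnS.
  by rewrite natrB //; ring.
have TS m : T m.+1 + S m.+1 = cat m.+1 + T m *+ 4 + S m *+ 2.
  rewrite -big_split big_ord_recl /= mul0r add0r catalan0 mul1r subn0 -addrA.
  congr (_ + _); rewrite -!sumrMnl -big_split /=; apply: eq_bigr => i _.
  rewrite /bump /= add1n subSS -mulr_natl.
  have := catalanS i; rewrite natrD natrM => H.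
  transitivity ((i.+2%:R * cat i.+1) * cat (m - i)%N).
    by rewrite -(natr1 i.+1); ring.
  by rewrite H; ring.
rewrite -/(S n); elim: n => [|n IH].
  rewrite /S big_ord_recl big_ord0 subn0 catalan0.
  by have := catalanS 0; rewrite catalan0; lra.
have n3 : n.+3%:R != 0 :> R by rewrite pnatr_eq0.
apply: (mulfI n3); rewrite catalanS.
have := TS n; have := ST n; have := ST n.+1; rewrite IH.
rewrite -(natr1 n.+2) -(natr1 n.+1) -(natr1 n) natrD natrM.
move: (T n) (T n.+1) (S n.+1) (cat n.+1) => t t1 s1 c; lra.
Qed.

Lemma card_S312 n : #|S312 n|%:R = cat n.
Proof.
elim/ltn_ind: n => -[_|n IH]; first by rewrite card_S312_0 catalan0.
rewrite card_S312_rec natr_sum -catalan_conv; apply: eq_bigr => i _.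
by rewrite natrM !IH //; have := ltn_ord i; lia.
Qed.

Lemma central0 : central 0 = 1.
Proof. by rewrite /central bin0 expr0 divr1. Qed.

Lemma centralE n : central n = n.+1%:R * cat n / 4 ^+ n.
Proof. by rewrite catalanE. Qed.

Lemma central_gt0 n : 0 < central n.
Proof.
by rewrite /central divr_gt0 ?exprn_gt0 // ltr0n bin_gt0; lia.
Qed.

Lemma centralS n : (2 * n%:R + 2) * central n.+1 = (2 * n%:R + 1) * central n.
Proof.
have H := catalanS n; move: H; rewrite !centralE exprS natrD natrM => ->.
have : (4 : R) ^+ n != 0 by rewrite expf_neq0.
by rewrite -(natr1 n) => ?; field.
Qed.

Lemma sum_catalan n : \sum_(i < n) cat i / 4 ^+ i.+1 = (1 - central n) / 2.
Proof.
elim: n => [|n IH]; first by rewrite big_ord0 central0 subrr mul0r.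
rewrite big_ord_recr /= IH.
have nn : n%:R + 1 != 0 :> R by rewrite natr1 pnatr_eq0.
have H : cat n / 4 ^+ n.+1 = central n / (4 * (n%:R + 1)).
  have : (4 : R) ^+ n != 0 by rewrite expf_neq0.
  by rewrite centralE exprS -(natr1 n) => ?; field; rewrite ?nn.
have := centralS n => S1.
have -> : central n.+1 = (2 * n%:R + 1) / (2 * (n%:R + 1)) * central n.
  have q : 2 * n%:R + 2 != 0 :> R by rewrite -natrM -natrD pnatr_eq0 addn2.
  by apply: (mulfI q); rewrite S1; field.
by rewrite H; field.
Qed.

Lemma sum_central n : \sum_(i < n) central i = 2 * n%:R * central n.
Proof.
elim: n => [|n IH]; first by rewrite big_ord0 mulr0 mul0r.
rewrite big_ord_recr /= IH -(natr1 n).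
have := centralS n.
lra.
Qed.

(** Both bounds on the decay of the central probabilities hold by induction,
    because (2n+1)(2n+3) <= (2n+2)^2 and 4n(n+1) <= (2n+1)^2. *)
Lemma central_sqr_le n : (2 * n%:R + 1) * central n ^+ 2 <= 1.
Proof.
elim: n => [|n IH]; first by rewrite central0; lra.
have n0 : 0 <= n%:R :> R by [].
have c0 := central_gt0 n.
have q0 : 0 < (2 * n%:R + 2) ^+ 2 :> R by rewrite exprn_gt0 //; lra.
rewrite -(ler_pM2l q0) mulr1 -(natr1 n).
have -> : (2 * n%:R + 2) ^+ 2 * ((2 * (n%:R + 1) + 1) * central n.+1 ^+ 2) =
  (2 * n%:R + 3) * ((2 * n%:R + 2) * central n.+1) ^+ 2 by ring.
rewrite centralS.
have -> : (2 * n%:R + 3) * ((2 * n%:R + 1) * central n) ^+ 2 =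
  ((2 * n%:R + 3) * (2 * n%:R + 1)) * ((2 * n%:R + 1) * central n ^+ 2) by ring.
apply: (@le_trans _ _ ((2 * n%:R + 3) * (2 * n%:R + 1) * 1)).
  by apply: ler_wpM2l => //; apply: mulr_ge0; lra.
nra.
Qed.

Lemma central_sqr_ge n : (0 < n)%N -> 1 <= 4 * n%:R * central n ^+ 2.
Proof.
elim: n => [//|n IH] _.
have := centralS n; have [->|n1 S1] := eqVneq n 0%N.
  rewrite central0 mulr0 !add0r => H.
  have -> : central 1 = 1 / 2 by lra.
  by rewrite expr2; lra.
have {}IH : 1 <= 4 * n%:R * central n ^+ 2 by apply: IH; rewrite lt0n.
have n0 : 0 <= n%:R :> R by [].
have q0 : 0 < (2 * n%:R + 2) ^+ 2 :> R by rewrite exprn_gt0 //; lra.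
rewrite -(ler_pM2l q0) mulr1 -(natr1 n).
have -> : (2 * n%:R + 2) ^+ 2 * (4 * (n%:R + 1) * central n.+1 ^+ 2) =
  4 * (n%:R + 1) * ((2 * n%:R + 2) * central n.+1) ^+ 2 by ring.
rewrite S1.
have -> : 4 * (n%:R + 1) * ((2 * n%:R + 1) * central n) ^+ 2 =
  (4 * (n%:R + 1) * (2 * n%:R + 1) ^+ 2) * central n ^+ 2 by ring.
apply: (@le_trans _ _ ((2 * n%:R + 2) ^+ 2 * (4 * n%:R * central n ^+ 2))).
  by apply: ler_peMr => //; apply: ltW.
rewrite mulrA; apply: ler_wpM2r; first exact: sqr_ge0.
nra.
Qed.

End Catalan.

Lemma catalan_ratioS (R : realType) :
  (fun n => catalan R n / catalan R n.+1) @ \oo --> (4 : R)^-1.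
Proof.
have -> : (fun n => catalan R n / catalan R n.+1) =
  (fun n => (1 + harmonic n) / (4 - 2 * harmonic n)).
  apply/funext => n; rewrite /harmonic /=.
  have n1 : n.+1%:R != 0 :> R by rewrite pnatr_eq0.
  have n0 : 0 <= n%:R :> R by [].
  have n2 : n%:R + 1 + 1 != 0 :> R by rewrite gt_eqF //; lra.
  have n4 : 4 * n%:R + 2 != 0 :> R by rewrite gt_eqF //; lra.
  have := catalanS R n; have := catalan_gt0 R n; have := catalan_gt0 R n.+1.
  move=> c1 c0 H.
  have -> : catalan R n.+1 = (4 * n%:R + 2) / (n%:R + 1 + 1) * catalan R n.
    apply: (mulfI n2); move: H.
    by rewrite natrD natrM -(natr1 n.+1) -(natr1 n) => ->; field.
  have := gt_eqF c0; move: n1; rewrite -(natr1 n) => n1 cn.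
  by field; rewrite ?n1 ?n2 ?n4 ?cn /= ?gt_eqF //; lra.
rewrite -[X in _ --> X](_ : (1 + 0) / (4 - 2 * 0) = _); last first.
  by rewrite mulr0 subr0 addr0 mul1r.
apply: cvgM; first by apply: cvgD; [exact: cvg_cst | exact: cvg_harmonic].
apply: cvgV; first by rewrite mulr0 subr0.
apply: cvgB; first exact: cvg_cst.
by apply: cvgM; [exact: cvg_cst | exact: cvg_harmonic].
Qed.

Lemma catalan_ratio (R : realType) k :
  (fun n => catalan R n / catalan R (n + k)) @ \oo --> ((4 : R) ^+ k)^-1.
Proof.
elim: k => [|k IH].
  rewrite expr0 invr1; apply: cvg_near_cst; apply: nearW => n.
  by rewrite addn0 divff // gt_eqF // catalan_gt0.
have -> : (fun n => catalan R n / catalan R (n + k.+1)) =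
  (fun n => (catalan R n / catalan R (n + k)) *
     (catalan R (n + k) / catalan R (n + k).+1)).
  apply/funext => n; rewrite addnS; field.
  by rewrite !gt_eqF // catalan_gt0.
rewrite exprSr invfM; apply: cvgM => //.
rewrite (cvg_shiftn k (fun n => catalan R n / catalan R n.+1)).
exact: catalan_ratioS.
Qed.

Lemma central_to0 (R : realType) (e : R) : 0 < e -> exists K, central R K < e.
Proof.
move=> e0; pose K := Num.truncn ((e ^+ 2)^-1); exists K.
have := central_sqr_le R K; have c0 := central_gt0 R K.
have e2 : 0 < e ^+ 2 by rewrite exprn_gt0.
have : (e ^+ 2)^-1 < K.+1%:R by exact: truncnS_gt.
rewrite -(ltr_pM2l e2) mulfV ?gt_eqF // -natr1 => H1 H2.
rewrite ltNge; apply/negP => ec.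
have : e ^+ 2 <= central R K ^+ 2 by rewrite lerXn2r ?nnegrE // ltW.
have : 0 <= K%:R :> R by [].
nra.
Qed.

Lemma central_unbounded (R : realType) (A : R) :
  exists2 K, (0 < K)%N & A <= K%:R * central R K.
Proof.
pose K := (Num.truncn (4 * A ^+ 2)).+1; exists K => //.
have := central_sqr_ge R (ltn0Sn (Num.truncn (4 * A ^+ 2))); rewrite -/K.
have H : 4 * A ^+ 2 < K%:R by exact: truncnS_gt.
have c0 := central_gt0 R K.
have k0 : 0 < K%:R :> R by rewrite ltr0n.
move=> H1; rewrite leNgt; apply/negP => H2.
have : (K%:R * central R K) ^+ 2 < A ^+ 2.
  have p : 0 <= K%:R * central R K by apply: mulr_ge0; apply: ltW.
  by rewrite ltrXn2r // nnegrE // (le_trans p) // ltW.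
rewrite exprMn => H3.
have : K%:R <= K%:R * (4 * K%:R * central R K ^+ 2) by rewrite ler_peMr // ltW.
lra.
Qed.

(** * Countable unions and intersections of events *)

Lemma measurable_exists d (T : measurableType d) (I : countType)
    (F : I -> set T) :
  (forall i, measurable (F i)) -> measurable [set w | exists i, F i w].
Proof.
move=> mF.
have -> : [set w | exists i, F i w] =
    \bigcup_n (if @unpickle I n is Some i then F i else set0).
  apply/seteqP; split=> w /= => [[i Fi]|[n _]].
    by exists (pickle i) => //; rewrite pickleK.
  by case: unpickle => // i Fi; exists i.
by apply: bigcupT_measurable => n; case: unpickle.
Qed.

Lemma measurable_forall d (T : measurableType d) (I : countType)
    (F : I -> set T) :
  (forall i, measurable (F i)) -> measurable [set w | forall i, F i w].
Proof.
move=> mF.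
have -> : [set w | forall i, F i w] = ~` [set w | exists i, (~` F i) w].
  apply/seteqP; split=> w /= => [H [i]|H i]; first exact.
  by apply: contrapT => NF; apply: H; exists i.
by apply: measurableC; apply: measurable_exists => i; apply: measurableC.
Qed.

Lemma null_exists d (T : measurableType d) (R : realType) (P : probability T R)
    (I : countType) (F : I -> set T) :
  (forall i, P.-negligible (F i)) -> P.-negligible [set w | exists i, F i w].
Proof.
move=> nF.
have -> : [set w | exists i, F i w] =
    \bigcup_n (if @unpickle I n is Some i then F i else set0).
  apply/seteqP; split=> w /= => [[i Fi]|[n _]].
    by exists (pickle i) => //; rewrite pickleK.
  by case: unpickle => // i Fi; exists i.
apply: negligible_bigcup => n; case: unpickle => // .
exact: negligible_set0.
Qed.

(** * Finite-dimensional laws of the limit process *)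

Definition config : Type := nat -> nat -> bool.

(** The observables that depend on a finite window: exactly those to which the
    convergence of finite-dimensional distributions applies. *)
Definition finitary (g : config -> bool) : Prop :=
  exists K, forall c c' : config,
    (forall i j, (i < K)%N -> (j < K)%N -> c i j = c' i j) -> g c = g c'.

Definition proportion (R : realType) (N : nat) (g : config -> bool) : R :=
  #|[set s in S312 N | g (cfg s)]|%:R / #|S312 N|%:R.

Definition pt (i j : nat) : lattice := (- (i.+1)%:Z, j.+1%:Z).

Lemma pt_Q i j : Q (pt i j).
Proof. by exists i.+1, j.+1. Qed.

Definition ptQ i j : Q := SigSub (mem_set (pt_Q i j)).

Section LimitLaw.
Variables (R : realType) (d : measure_display) (T : measurableType d).
Variables (P : probability T R) (X : Q -> {RV P >-> bool}).

Definition conf (w : T) : config := fun i j => X (ptQ i j) w.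

Definition event (g : config -> bool) : set T := [set w | g (conf w)].

Lemma measurable_point i j b : measurable [set w | conf w i j = b].
Proof.
exact: (@measurable_funPTI _ _ _ _ (X (ptQ i j)) [set b]).
Qed.

Lemma measurable_event g : finitary g -> measurable (event g).
Proof.
move=> [K gK].
(* a table on the window is extended by empty sites *)
pose ext (h : {ffun 'I_K * 'I_K -> bool}) : config := fun i j =>
  if (insub i, insub j) is (Some i', Some j') then h (i', j') else false.
have -> : event g = [set w | exists h : {ffun 'I_K * 'I_K -> bool},
    [set w | g (ext h) /\ forall p : 'I_K * 'I_K, conf w p.1 p.2 = h p] w].
  rewrite /event; apply/seteqP; split=> w /= => [gw|[h [gh wh]]].
    exists [ffun p : 'I_K * 'I_K => conf w p.1 p.2]; split.
    2: by move=> p; rewrite ffunE.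
    rewrite (gK _ (conf w)) // => i j iK jK.
    by rewrite /ext (insubT (ltn^~ K) iK) (insubT (ltn^~ K) jK) ffunE.
  rewrite (gK _ (ext h)) // => i j iK jK.
  by rewrite /ext (insubT (ltn^~ K) iK) (insubT (ltn^~ K) jK) -wh.
apply: measurable_exists => h; case: (boolP (g (ext h))) => gh.
  rewrite (_ : mkset _ = [set w | forall p : 'I_K * 'I_K,
      [set w | conf w p.1 p.2 = h p] w]).
    by apply: measurable_forall => p; exact: measurable_point.
  by apply/seteqP; split => w //= [].
rewrite (_ : mkset _ = set0); first exact: measurable0.
by apply/seteqP; split => w //= [].
Qed.

Hypothesis hX : limit_of_XN X.

(** Convergence in distribution, restated for one observable. *)
Lemma proportion_cvg g : finitary g ->
  proportion R N g @[N --> \oo] --> fine (P (event g)).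
Proof.
move=> fg; have [K gK] := fg.
pose C : {fset Q} := [fset q in [seq ptQ i j | i <- iota 0 K, j <- iota 0 K]]%fset.
have inC i j : (i < K)%N -> (j < K)%N -> ptQ i j \in C.
  by move=> iK jK; rewrite !inE; apply: allpairs_f; rewrite mem_iota.
pose ext (h : {ffun C -> bool}) : config := fun i j =>
  if insub (ptQ i j) is Some q then h q else false.
have extE (B : Q -> bool) i j : (i < K)%N -> (j < K)%N ->
    ext [ffun q : C => B (val q)] i j = B (ptQ i j).
  by move=> iK jK; rewrite /ext (insubT (fun q => q \in C) (inC _ _ iK jK)) ffunE.
have := @hX C (fun h : {ffun C -> bool} => (g (ext h))%:R).
have -> : (fun w => (g (ext [ffun q : C => X (val q) w]))%:R) =
    \1_(event g) :> (T -> R).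
  apply/funext => w; rewrite indicE.
  have -> : g (ext [ffun q : C => X (val q) w]) = g (conf w).
    by apply: gK => i j iK jK; rewrite (extE (fun q => X q w)).
  congr (_%:R); congr nat_of_bool; apply/idP/idP; by rewrite inE.
rewrite expectation_indic; last exact: measurable_event.
have Pf : P (event g) \is a fin_num.
  by apply: fin_num_measure; exact: measurable_event.
rewrite -[P (event g)]fineK //.
have -> : (fun n => (expect312 (R := R) (fun s : 'S_n =>
     (g (ext [ffun q : C => XN s (val (val q))]))%:R))%:E) =
   (fun n => (proportion R n g)%:E).
  apply/funext => n; congr (_%:E); rewrite /expect312 /proportion; congr (_ / _).
  rewrite -sum1_card natr_sum.
  rewrite (eq_bigr (fun s => (g (cfg s))%:R)); last first.
    move=> s _; congr (_%:R); congr nat_of_bool.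
    by apply: gK => i j iK jK; rewrite (extE (fun q => XN s (val q))).
  rewrite [RHS]big_mkcond [LHS]big_mkcond /=; apply: eq_bigr => s _.
  by rewrite !inE; case: (avoids312 s) => //=; case: (g _).
by move=> /fine_cvgP[_].
Qed.

End LimitLaw.

(** * The renewal property *)

Lemma finitary_point i j : finitary (fun c => c i j).
Proof. by exists (i + j).+1 => c c' cc'; apply: cc'; lia. Qed.

Lemma finitary_const b : finitary (fun=> b).
Proof. by exists 0%N. Qed.

Lemma finitary_not g : finitary g -> finitary (fun c => ~~ g c).
Proof. by move=> [K gK]; exists K => c c' /gK ->. Qed.

Lemma finitary_and g h : finitary g -> finitary h -> finitary (fun c => g c && h c).
Proof.
move=> [K gK] [L hL]; exists (maxn K L) => c c' cc'.
by rewrite (gK c c') ?(hL c c') // => i j ik jk; apply: cc'; lia.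
Qed.

Lemma finitary_forall (I : finType) (g : I -> config -> bool) :
  (forall i, finitary (g i)) -> finitary (fun c => [forall i, g i c]).
Proof.
move=> /choice[K gK]; exists (\max_i K i) => c c' cc'; apply: eq_forallb => i.
by apply: gK => k l kK lK; apply: cc'; apply: leq_trans (leq_bigmax i).
Qed.

Lemma finitary_translate g a b :
  finitary g -> finitary (fun c => g (translate c a b)).
Proof.
move=> [K gK]; exists (K + a.+1 + b.+1)%N => c c' cc'.
by apply: gK => i j iK jK; apply: cc'; lia.
Qed.

Lemma finitary_corner a b : finitary (fun c => corner c a b).
Proof.
apply: finitary_and; first exact: finitary_point.
apply: finitary_forall => i; apply: finitary_forall => j.
have [K gK] := finitary_point i j.
by exists K => c c' /gK ->.
Qed.

Lemma proportion_renewal (R : realType) a b M g :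
  proportion R (M + (a + b).+1)
      (fun c => corner c a b && g (translate c a b)) =
  catalan R a * catalan R b * (catalan R M / catalan R (M + (a + b).+1)) *
    proportion R M g.
Proof.
rewrite /proportion (@card_corner a b M); last by lia.
rewrite !natrM !card_S312; field.
by rewrite !gt_eqF // catalan_gt0.
Qed.

Section Renewal.
Variables (R : realType) (d : measure_display) (T : measurableType d).
Variables (P : probability T R) (X : Q -> {RV P >-> bool}).
Hypothesis hX : limit_of_XN X.

Definition prob (g : config -> bool) : R := fine (P (event X g)).

Lemma probE g : finitary g -> P (event X g) = (prob g)%:E.
Proof.
by move=> fg; rewrite fineK // fin_num_measure //; exact: measurable_event.
Qed.

(** The limit process starts afresh at a corner: this is [card_corner] divided by
    the number of avoiding permutations, where the ratio of the two Catalan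
    numbers that are far out tends to a power of 1/4. *)
Lemma prob_renewal a b g : finitary g ->
  prob (fun c => corner c a b && g (translate c a b)) =
  step_law R a.+1 b.+1 * prob g.
Proof.
move=> fg; set G := (fun c => _).
have fG : finitary G.
  by apply: finitary_and; [exact: finitary_corner | exact: finitary_translate].
have := proportion_cvg hX fG.
rewrite -(cvg_shiftn (a + b).+1) => /cvg_lim H.
rewrite /prob -[LHS]H //; apply/cvg_lim => //.
have -> : (fun n => proportion R (n + (a + b).+1) G) =
  (fun n => catalan R a * catalan R b * (catalan R n / catalan R (n + (a + b).+1)) *
      proportion R n g).
  by apply/funext => n; exact: proportion_renewal.
rewrite /step_law (_ : (a.+1 + b.+1 - 1 = (a + b).+1)%N); last by lia.
apply: cvgM; last exact: proportion_cvg.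
by apply: cvgM; [exact: cvg_cst | exact: catalan_ratio].
Qed.

(** By [points_beyond_corner] the corresponding sets of permutations are empty
    as soon as N is large. *)
Lemma prob_far a b i j : ~ (i = a /\ j = b) -> ~ ((a < i)%N /\ (b < j)%N) ->
  prob (fun c => corner c a b && c i j) = 0.
Proof.
move=> ne nlt; set G := (fun c => _).
have fG : finitary G.
  by apply: finitary_and; [exact: finitary_corner | exact: finitary_point].
have := proportion_cvg hX fG => /cvg_lim H.
rewrite /prob -[LHS]H //; apply/cvg_lim => //.
apply: cvg_near_cst; exists (a + b + i + j).+1 => // n /= nbig.
rewrite /proportion (_ : [set s in _ | _] = finset.set0) ?cards0 ?mul0r //.
apply/setP => s; rewrite finset.in_set0 inE; apply/negbTE/negP => /and3P[sA sc sij].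
by have := points_beyond_corner sA sc sij; lia.
Qed.

Definition no_corner (K : nat) (c : config) : bool :=
  [forall p : 'I_K * 'I_K, ~~ corner c p.1 p.2].

Lemma finitary_no_corner K : finitary (no_corner K).
Proof.
by apply: finitary_forall => p; apply: finitary_not; exact: finitary_corner.
Qed.

(** Two distinct corners exclude each other, for each would have to lie beyond
    the other one. *)
Lemma proportion_no_corner K N : (2 * K <= N)%N ->
  proportion R N (no_corner K) =
  1 - \sum_(p : 'I_K * 'I_K) proportion R N (fun c => corner c p.1 p.2).
Proof.
move=> KN; rewrite /proportion -mulr_suml.
have S0 : #|S312 N|%:R != 0 :> R by rewrite card_S312 gt_eqF // catalan_gt0.
apply: (mulIf S0); rewrite mulrBl !mulfVK // mul1r; apply/eqP.
rewrite eq_sym subr_eq -natr_sum -natrD eqr_nat; apply/eqP.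
have cardE (g : config -> bool) :
    #|[set s in S312 N | g (cfg s)]| = (\sum_(s in S312 N) g (cfg s))%N.
  rewrite -sum1_card [LHS]big_mkcond [RHS]big_mkcond; apply: eq_bigr => s _.
  by rewrite !inE; case: (avoids312 s) => //=; case: (g _).
rewrite cardE.
rewrite (eq_bigr _ (fun (p : 'I_K * 'I_K) _ => cardE (fun c => corner c p.1 p.2))).
rewrite exchange_big -big_split -sum1_card /=; apply: eq_bigr => s sA.
have [/forallP H|] := boolP (no_corner K (cfg s)).
  by rewrite big1 // => p _; rewrite (negbTE (H p)).
rewrite negb_forall => /existsP[[p1 p2] /= /negPn sp].
rewrite (bigD1 (p1, p2)) //= sp add0n big1 // => -[q1 q2] /= qp.
apply/eqP; rewrite eqb0; apply/negP => sq; case/eqP: qp.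
suff [-> ->] : q1 = p1 /\ q2 = p2 by [].
have /cornerP[cp Hp] := sp; have /cornerP[cq Hq] := sq.
have := ltn_ord p1; have := ltn_ord p2; have := ltn_ord q1; have := ltn_ord q2.
move=> h1 h2 h3 h4.
have [|||[lt1 lt2]] := points_beyond_corner sA sp cq; [lia | lia | |].
  by move=> [/val_inj-> /val_inj->].
by have [/val_inj<- /val_inj<-] := Hq p1 p2 (ltnW lt1) (ltnW lt2) cp.
Qed.

Lemma sum_step_law K :
  \sum_(p : 'I_K * 'I_K) step_law R (val p.1).+1 (val p.2).+1 =
  (1 - central R K) ^+ 2.
Proof.
rewrite -(pair_bigA _ (fun i j : 'I_K => step_law R i.+1 j.+1)) /=.
have -> : 1 - central R K = 2 * \sum_(i < K) catalan R i / 4 ^+ i.+1.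
  by rewrite sum_catalan; field.
rewrite expr2 [RHS]mulrACA big_distrlr mulr_sumr; apply: eq_bigr => i _ /=.
rewrite mulr_sumr; apply: eq_bigr => j _.
rewrite /step_law (_ : (i.+1 + j.+1 - 1 = i + j.+1)%N) /=; last by lia.
have : (4 : R) ^+ i != 0 by rewrite expf_neq0.
have : (4 : R) ^+ j != 0 by rewrite expf_neq0.
by rewrite exprD !exprS => ? ?; field; apply/andP.
Qed.

Lemma prob_true : prob (fun=> true) = 1.
Proof.
rewrite /prob (_ : event _ _ = setT) ?probability_setT //.
by apply/seteqP; split.
Qed.

Lemma prob_corner a b : prob (fun c => corner c a b) = step_law R a.+1 b.+1.
Proof.
have := prob_renewal a b (finitary_const true); rewrite prob_true mulr1 => <-.
by rewrite /prob; congr (fine (P _)); apply/funext => w; rewrite /event /= andbT.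
Qed.

(** Since [central R K] tends to 0, this shows that a corner exists almost
    surely. *)
Lemma prob_no_corner K : prob (no_corner K) = 1 - (1 - central R K) ^+ 2.
Proof.
have /cvg_lim H := proportion_cvg hX (finitary_no_corner K).
rewrite /prob -[LHS]H //; apply/cvg_lim => //.
rewrite -sum_step_law.
apply: (@cvg_trans _ ((fun N => 1 - \sum_(p : 'I_K * 'I_K)
     proportion R N (fun c => corner c p.1 p.2)) @ \oo)).
  apply: near_eq_cvg; exists (2 * K)%N => // n /= nK.
  by rewrite proportion_no_corner.
apply: cvgB; first exact: cvg_cst.
apply: cvg_big => [|p _]; first exact: add_continuous.
rewrite -prob_corner.
by apply: proportion_cvg => //; exact: finitary_corner.
Qed.

End Renewal.

(** * Successive corners *)

(** [chain s c] says that s lists the first corners of c, each read in the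
    coordinates of the preceding one; [translates s c] is what remains of c
    beyond them. *)
Fixpoint chain (s : seq (nat * nat)) (c : config) : bool :=
  if s is p :: s' then corner c p.1 p.2 && chain s' (translate c p.1 p.2) else true.

Fixpoint translates (s : seq (nat * nat)) (c : config) : config :=
  if s is p :: s' then translates s' (translate c p.1 p.2) else c.

Lemma chain_rcons s p c :
  chain (rcons s p) c = chain s c && corner (translates s c) p.1 p.2.
Proof. by elim: s c => [|q s IH] c /=; rewrite ?andbT ?IH ?andbA. Qed.

Lemma translates_rcons s p c :
  translates (rcons s p) c = translate (translates s c) p.1 p.2.
Proof. by elim: s c => [|q s IH] c /=. Qed.

Lemma finitary_chain_and s g : finitary g ->
  finitary (fun c => chain s c && g (translates s c)).
Proof.
move=> fg; elim: s => [//|p s IH] /=.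
have [K H] := finitary_and (finitary_corner p.1 p.2) (finitary_translate p.1 p.2 IH).
by exists K => c c' cc'; rewrite -2!andbA (H c c' cc').
Qed.

(** The second clause makes the corner unique ([renewal_corner_uniq]) and
    confines all other points to the quadrant beyond it. *)
Definition renewal_at (c : config) : Prop :=
  (exists p : nat * nat, corner c p.1 p.2) /\
  forall pq : (nat * nat) * (nat * nat),
    corner c pq.1.1 pq.1.2 && c pq.2.1 pq.2.2 ==>
    ((pq.2 == pq.1) || (pq.1.1 < pq.2.1) && (pq.1.2 < pq.2.2))%N.

Lemma renewal_corner_uniq c p q : renewal_at c ->
  corner c p.1 p.2 -> corner c q.1 q.2 -> p = q.
Proof.
move=> [_ rc] /[dup] cp /cornerP[pp Hp] /cornerP[qq Hq].
have /implyP := rc (p, q); rewrite /= cp qq => /(_ isT) /orP[/eqP//|/andP[h1 h2]].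
have [e _] := Hq p.1 p.2 (ltnW h1) (ltnW h2) pp.
by rewrite e ltnn in h1.
Qed.

Definition first_corner (c : config) : nat * nat :=
  xget (0, 0)%N [set p | corner c p.1 p.2].

Lemma first_cornerP c :
  renewal_at c -> corner c (first_corner c).1 (first_corner c).2.
Proof.
by move=> [[p cp] _]; apply: (@xgetPex _ _ [set p | corner c p.1 p.2]); exists p.
Qed.

Definition residual (c : config) (m : nat) : config :=
  iter m (fun c => translate c (first_corner c).1 (first_corner c).2) c.

Section Chains.
Variables (R : realType) (d : measure_display) (T : measurableType d).
Variables (P : probability T R) (X : Q -> {RV P >-> bool}).
Hypothesis hX : limit_of_XN X.
Local Notation conf := (conf X).
Local Notation event := (event X).
Local Notation prob := (prob X).

Definition weight (s : seq (nat * nat)) : R :=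
  \prod_(p <- s) step_law R p.1.+1 p.2.+1.

Lemma step_law_ge0 a b : 0 <= step_law R a b.
Proof.
by rewrite /step_law divr_ge0 ?exprn_ge0 // mulr_ge0 // ltW // catalan_gt0.
Qed.

Lemma weight_ge0 s : 0 <= weight s.
Proof. by apply: prodr_ge0 => p _; exact: step_law_ge0. Qed.

(** The renewal property iterated: after any finite list of corners the rest is
    distributed as the whole. *)
Lemma prob_chain s g : finitary g ->
  prob (fun c => chain s c && g (translates s c)) = weight s * prob g.
Proof.
move=> fg; elim: s => [|p s IH] /=; first by rewrite /weight big_nil mul1r.
rewrite /weight big_cons -/(weight s) -mulrA -IH -prob_renewal //.
2: exact: finitary_chain_and.
by rewrite /prob; congr (fine (P _)); apply/funext => w; rewrite /event /= andbA.
Qed.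

Lemma finitary_implyb g b : finitary g -> finitary (fun c => g c ==> b).
Proof. by move=> [K gK]; exists K => c c' /gK ->. Qed.

(** Quantifying over all lists rather than over the actual one keeps this a
    countable intersection of finite-window events. *)
Definition regular : set T :=
  [set w | forall s, chain s (conf w) -> renewal_at (translates s (conf w))].

Lemma finitary_chain s : finitary (chain s).
Proof.
have [K H] := finitary_chain_and s (finitary_const true).
by exists K => c c' /H; rewrite !andbT.
Qed.

Lemma finitary_translates s g : finitary g -> finitary (fun c => g (translates s c)).
Proof.
elim: s g => [//|p s IH] g fg; exact: (finitary_translate p.1 p.2 (IH g fg)).
Qed.

Lemma measurable_regular : measurable regular.
Proof.
have -> : regular = [set w | forall s, (~` event (chain s) `|`
   ([set w | exists p : nat * nat,
       event (fun c => corner (translates s c) p.1 p.2) w] `&`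
    [set w | forall pq : (nat * nat) * (nat * nat),
       event (fun c => corner (translates s c) pq.1.1 pq.1.2 &&
                         translates s c pq.2.1 pq.2.2
           ==> ((pq.2 == pq.1) || (pq.1.1 < pq.2.1) && (pq.1.2 < pq.2.2))%N) w])) w].
  apply/seteqP; split=> w /= H s.
    by case: (boolP (chain s (conf w))) => cs; [right; exact: H | left; exact/negP].
  by case: (H s).
apply: measurable_forall => s; apply: measurableU.
  by apply/measurableC/measurable_event/finitary_chain.
apply: measurableI.
  apply: measurable_exists => p; apply/measurable_event.
  by apply: (finitary_translates s (finitary_corner p.1 p.2)).
apply: measurable_forall => p; apply/measurable_event/finitary_implyb.
apply: (@finitary_translates s (fun c => corner c p.1.1 p.1.2 && c p.2.1 p.2.2)).
by apply: finitary_and; [exact: finitary_corner | exact: finitary_point].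
Qed.

(** For every K the event is contained in the absence of a corner from the K x K
    box, whose probability is at most 2 [central R K]. *)
Lemma stuck_null s : P.-negligible [set w | chain s (conf w) /\
  forall p : nat * nat, ~ corner (translates s (conf w)) p.1 p.2].
Proof.
set A := mkset _.
have mA : measurable A.
  have -> : A = event (chain s) `&` [set w | forall p : nat * nat,
      event (fun c => ~~ corner (translates s c) p.1 p.2) w].
    by apply/seteqP; split => w [cs H]; split => // p; apply/negP; exact: H.
  apply: measurableI; first by apply/measurable_event/finitary_chain.
  apply: measurable_forall => p; apply/measurable_event/finitary_not.
  exact: (finitary_translates s (finitary_corner p.1 p.2)).
have le_prob K : (P A <= (weight s * (2 * central R K))%:E)%E.
  have fK := finitary_chain_and s (finitary_no_corner K).
  apply: (@le_trans _ _
    (P (event (fun c => chain s c && no_corner K (translates s c))))).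
    apply: le_measure; rewrite ?inE //; first exact: measurable_event.
    move=> w [cs H]; rewrite /event /= cs /=; apply/forallP => p.
    exact/negP/(H (val p.1, val p.2)).
  rewrite (probE _ fK) lee_fin prob_chain; last exact: finitary_no_corner.
  apply: ler_wpM2l; first exact: weight_ge0.
  by rewrite prob_no_corner //; have := sqr_ge0 (central R K); nra.
exists A; split=> //; apply/eqP; rewrite eq_le measure_ge0 andbT.
apply/lee_addgt0Pr => e e0; rewrite add0e.
have w0 := weight_ge0 s.
have [|K cK] := @central_to0 R (e / (2 * weight s + 1)).
  by apply: divr_gt0 => //; lra.
apply: (le_trans (le_prob K)); rewrite lee_fin.
move: cK; rewrite ltr_pdivlMr; last by lra.
have := central_gt0 R K; nra.
Qed.

Lemma stray_null s (p q : nat * nat) :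
    ~~ ((q == p) || (p.1 < q.1) && (p.2 < q.2))%N ->
  P.-negligible (event (fun c => chain s c &&
     (corner (translates s c) p.1 p.2 && translates s c q.1 q.2))).
Proof.
rewrite negb_or negb_and => /andP[qp /orP lt].
have fg : finitary (fun c : config => corner c p.1 p.2 && c q.1 q.2).
  by apply: finitary_and; [exact: finitary_corner | exact: finitary_point].
apply/negligibleP; first exact/measurable_event/(finitary_chain_and s fg).
apply: (etrans (probE X (finitary_chain_and s fg))); congr (_%:E).
rewrite (prob_chain s fg) prob_far ?mulr0 //.
- move=> [q1 q2]; move: qp.
  by rewrite (surjective_pairing q) q1 q2 -surjective_pairing eqxx.
- by move=> [q1 q2]; move: lt; rewrite q1 q2; case.
Qed.

Lemma irregular_null : P.-negligible (~` regular).
Proof.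
pose stuck s : set T := [set w | chain s (conf w) /\
  forall p : nat * nat, ~ corner (translates s (conf w)) p.1 p.2].
pose stray s (pq : (nat * nat) * (nat * nat)) : set T :=
  [set w | event (fun c => chain s c &&
     (corner (translates s c) pq.1.1 pq.1.2 && translates s c pq.2.1 pq.2.2)) w /\
   ~~ ((pq.2 == pq.1) || (pq.1.1 < pq.2.1) && (pq.1.2 < pq.2.2))%N].
have N : P.-negligible
    [set w | exists s, (stuck s `|` [set w | exists pq, stray s pq w]) w].
  apply: null_exists => s; apply: negligibleU; first exact: stuck_null.
  apply: null_exists => -[p q].
  case: (boolP ((q == p) || (p.1 < q.1) && (p.2 < q.2))%N) => pq.
    apply: (@negligibleS _ _ _ P set0); last exact: negligible_set0.
    by move=> w [_]; rewrite /= pq.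
  by apply: negligibleS (stray_null s pq) => w [].
apply: negligibleS N => w /= /existsNP[s /not_implyP[cs /not_andP nr]]; exists s.
case: nr => [nc|/existsNP[pq /negP]].
  by left; split=> // p cp; apply: nc; exists p.
rewrite negb_imply => /andP[H npq]; right; exists pq; split => //.
by rewrite /event /= cs.
Qed.

Lemma probability_eq_regular (A B : set T) : measurable A -> measurable B ->
  (forall w, regular w -> A w <-> B w) -> P A = P B.
Proof.
move=> mA mB AB; have mG := measurable_regular.
have null0 D : measurable D -> P (D `\` regular) = 0.
  move=> mD; apply: measure_negligible; first exact: measurableD.
  by apply: negligibleS irregular_null => w [].
have split_regular D : measurable D -> P D = P (D `&` regular).
  move=> mD; transitivity (P (D `\` regular) + P (D `&` regular))%E.
    exact: measureDI.
  by rewrite null0 // add0e.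
rewrite (split_regular A mA) (split_regular B mB); congr (P _).
by apply/seteqP; split => w [Dw gw]; split => //; apply/(AB w gw).
Qed.

(** The default (0, 0) on irregular outcomes stands for the step (-1, 1), so that
    all increments lie in Q without exception. *)
Definition increment (w : T) (m : nat) : nat * nat :=
  if `[< regular w >] then first_corner (residual (conf w) m) else (0, 0)%N.

Definition history (w : T) (m : nat) : seq (nat * nat) := mkseq (increment w) m.

Lemma history_chain w m : regular w ->
  chain (history w m) (conf w) /\
  translates (history w m) (conf w) = residual (conf w) m.
Proof.
move=> gw; elim: m => [//|m [IH1 IH2]].
rewrite /history mkseqS -/(history w m) chain_rcons translates_rcons IH1 IH2.
rewrite /increment asboolT //=; split=> //.
by apply: first_cornerP; rewrite -IH2; exact: gw.
Qed.

(** Together with [history_chain] this identifies, on regular outcomes, the event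
    that the first increments are s with the finite-window event [chain s]. *)
Lemma chain_history w s : regular w -> chain s (conf w) -> history w (size s) = s.
Proof.
move=> gw; elim/last_ind: s => [//|s p IH]; rewrite chain_rcons => /andP[cs cp].
rewrite size_rcons /history mkseqS -/(history w _) IH //; congr rcons.
rewrite /increment asboolT //.
have [_ E] := history_chain (size s) gw; rewrite IH // in E.
apply: (@renewal_corner_uniq (translates s (conf w))) => //; first exact: gw.
by rewrite -E; apply: first_cornerP; exact: gw.
Qed.

Lemma measurable_increment m p : measurable [set w | increment w m = p].
Proof.
have -> : [set w | increment w m = p] =
  (regular `&` [set w | exists s,
     [set w | size s = m /\ chain (rcons s p) (conf w)] w]) `|`
  (~` regular `&` [set w | (0, 0)%N = p]).
  apply/seteqP; split=> w /=.
    rewrite /increment; case: asboolP => gw; last by right.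
    move=> np; left; split => //; exists (history w m).
    split; first exact: size_mkseq.
    rewrite chain_rcons; have [-> ->] := history_chain m gw.
    have [h1 h2] := history_chain m gw.
    by rewrite -np; apply: first_cornerP; rewrite -h2; exact: gw.
  move=> [[gw [s [<- cs]]]|[ngw <-]]; last by rewrite /increment asboolF.
  have := chain_history gw cs; rewrite size_rcons /history mkseqS.
  by move=> /rcons_inj[].
apply: measurableU; apply: measurableI.
- exact: measurable_regular.
- apply: measurable_exists => s; have [e|ne] := eqVneq (size s) m.
    rewrite (_ : mkset _ = event (chain (rcons s p))).
      exact/measurable_event/finitary_chain.
    by apply/seteqP; split=> w //= [].
  rewrite (_ : mkset _ = set0); first exact: measurable0.
  by apply/seteqP; split=> w //= [/eqP]; rewrite (negbTE ne).
- exact/measurableC/measurable_regular.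
- have [<-|ne] := eqVneq (0, 0)%N p.
    rewrite (_ : mkset _ = setT); first exact: measurableT.
    by apply/seteqP; split.
  rewrite (_ : mkset _ = set0); first exact: measurable0.
  by apply/seteqP; split=> w //= /eqP; rewrite (negbTE ne).
Qed.

Lemma measurable_history m s : measurable [set w | history w m = s].
Proof.
have [e|ne] := eqVneq (size s) m; last first.
  rewrite (_ : mkset _ = set0); first exact: measurable0.
  apply/seteqP; split=> w //= h; move: ne.
  by rewrite -h size_mkseq eqxx.
rewrite (_ : mkset _ = [set w | forall i : 'I_m,
    [set w | increment w i = nth (0, 0)%N s i] w]).
  by apply: measurable_forall => i; exact: measurable_increment.
apply/seteqP; split=> w /=.
  by move=> <- i; rewrite nth_mkseq.
move=> H; apply: (@eq_from_nth _ (0, 0)%N); first by rewrite size_mkseq.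
by move=> i; rewrite size_mkseq => im; rewrite nth_mkseq // -(H (Ordinal im)).
Qed.

Lemma history_law s : P [set w | history w (size s) = s] = (weight s)%:E.
Proof.
have fs := finitary_chain s.
rewrite (@probability_eq_regular _ (event (chain s))).
- rewrite probE //; congr (_%:E).
  have := prob_chain s (finitary_const true); rewrite prob_true mulr1 => <-.
  by rewrite /prob; congr (fine (P _)); apply/funext => w; rewrite /event /= andbT.
- exact: measurable_history.
- exact: measurable_event.
move=> w gw; split=> /= [<-|]; first by have [] := history_chain (size s) gw.
exact: chain_history.
Qed.

End Chains.

(** * Product formulas for discrete variables *)

Lemma measurable_fibers d (T : measurableType d) (S : countType) (Y : T -> S)
    (B : set S) :
  (forall y, measurable [set w | Y w = y]) -> measurable [set w | B (Y w)].
Proof.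
move=> mY.
have -> : [set w | B (Y w)] =
    [set w | exists y, (if `[< B y >] then [set w | Y w = y] else set0) w].
  apply/seteqP; split=> w /= => [BY|[y]]; first by exists (Y w); rewrite asboolT.
  by case: asboolP => // By ->.
by apply: measurable_exists => y; case: ifP.
Qed.

Section FiberProduct.
Variables (R : realType) (d : measure_display) (T : measurableType d).
Variables (P : probability T R) (S : countType).

Lemma probability_fibers (Y : T -> S) (E : set T) (B : set S) :
    measurable E -> (forall y, measurable [set w | Y w = y]) ->
  P (E `&` [set w | B (Y w)]) =
  (\sum_(n <oo) P (E `&` [set w | B (Y w) /\ pickle (Y w) = n]))%E.
Proof.
move=> mE mY.
have -> : E `&` [set w | B (Y w)] =
    \bigcup_n (E `&` [set w | B (Y w) /\ pickle (Y w) = n]).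
  apply/seteqP; split=> w /= => [[Ew Bw]|[n _ [Ew [Bw _]]]] //.
  by exists (pickle (Y w)).
rewrite measure_bigcup //.
- by apply: eq_eseriesl => n; rewrite in_setT.
- move=> n _; apply: measurableI => //.
  exact: (measurable_fibers [set y | B y /\ pickle y = n]).
by move=> n m _ _ [w /= [[_ [_ <-]] [_ [_ <-]]]].
Qed.

(** A product formula for the values of a discrete variable extends to arbitrary
    sets of values by countable additivity. The variable Z only carries the
    law: the masses are then those of a measure by construction. *)
Lemma fiber_product (Y Z : T -> S) (E : set T) (c : R) (B : set S) :
    measurable E -> (forall y, measurable [set w | Y w = y]) ->
    (forall y, measurable [set w | Z w = y]) ->
    (forall y, P (E `&` [set w | Y w = y]) = (c%:E * P [set w | Z w = y])%E) ->
  P (E `&` [set w | B (Y w)]) = (c%:E * P [set w | B (Z w)])%E.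
Proof.
move=> mE mY mZ H.
rewrite probability_fibers // -[X in (_ * P X)%E]setTI probability_fibers //.
rewrite -nneseriesZl //; apply: eq_eseriesr => n _; rewrite setTI.
have [[y [By yn]]|Nn] := pselect (exists y, B y /\ pickle y = n).
  have fiber (U : T -> S) :
      [set w | B (U w) /\ pickle (U w) = n] = [set w | U w = y].
    apply/seteqP; split=> w /= => [[_]|->] //.
    by rewrite -yn => /(pcan_inj pickleK).
  by rewrite !fiber.
have fiber (U : T -> S) : [set w | B (U w) /\ pickle (U w) = n] = set0.
  by apply/seteqP; split=> w //= [Bw wn]; apply: Nn; exists (U w).
by rewrite !fiber setI0 measure0 mule0.
Qed.
End FiberProduct.

(** * Positions of the corners *)

Lemma translatesE s (c : config) i j :
  translates s c i j =
  c (\sum_(p <- s) p.1.+1 + i)%N (\sum_(p <- s) p.2.+1 + j)%N.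
Proof.
elim: s c i j => [|p s IH] c i j /=; first by rewrite !big_nil.
by rewrite IH /translate !big_cons; congr c; lia.
Qed.

Definition walk (s : seq (nat * nat)) : lattice := \sum_(p <- s) pt p.1 p.2.

Lemma walkE s :
  walk s = (- (\sum_(p <- s) p.1.+1)%N%:Z, (\sum_(p <- s) p.2.+1)%N%:Z).
Proof.
elim: s => [|p s IH]; first by rewrite /walk !big_nil oppr0.
have -> : walk (p :: s) = pt p.1 p.2 + walk s by rewrite /walk big_cons.
rewrite IH !big_cons /pt.
by congr pair; rewrite /=; lia.
Qed.

Lemma walk_rcons s p : walk (rcons s p) = walk s + pt p.1 p.2.
Proof. by rewrite /walk -cats1 big_cat big_seq1. Qed.

Lemma leq_size_sum (s : seq (nat * nat)) : (size s <= \sum_(p <- s) p.2.+1)%N.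
Proof. by elim: s => [|p s IH] //=; rewrite big_cons; lia. Qed.

Lemma sum_step_law_mean (R : realType) K :
  \sum_(p : 'I_K * 'I_K) (val p.1).+1%:R * step_law R (val p.1).+1 (val p.2).+1 =
  K%:R * central R K * (1 - central R K).
Proof.
rewrite -(pair_bigA _ (fun i j : 'I_K => i.+1%:R * step_law R i.+1 j.+1)) /=.
transitivity ((\sum_(i < K) central R i) * \sum_(j < K) catalan R j / 4 ^+ j.+1).
  rewrite mulr_suml; apply: eq_bigr => i _ /=.
  rewrite mulr_sumr; apply: eq_bigr => j _; rewrite centralE.
  rewrite /step_law (_ : (i.+1 + j.+1 - 1 = i + j.+1)%N) /=; last by lia.
  have : (4 : R) ^+ i != 0 by rewrite expf_neq0.
  have : (4 : R) ^+ j != 0 by rewrite expf_neq0.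
  by rewrite exprD !exprS => h1 h2; field; rewrite h1 h2.
by rewrite sum_central sum_catalan; field.
Qed.

Lemma step_law_sym (R : realType) a b : step_law R a b = step_law R b a.
Proof. by rewrite /step_law addnC [catalan R a.-1 * _]mulrC. Qed.

(** * The increments and the random set *)

Section RandomWalk.
Variables (R : realType) (d : measure_display) (T : measurableType d).
Variables (P : probability T R) (X : Q -> {RV P >-> bool}).
Hypothesis hX : limit_of_XN X.
Local Notation conf := (conf X).
Local Notation regular := (regular X).
Local Notation increment := (increment X).
Local Notation history := (history X).

Lemma history_increment m p s :
  P ([set w | increment w m = p] `&` [set w | history w m = s]) =
  ((step_law R p.1.+1 p.2.+1)%:E * P [set w | history w m = s])%E.
Proof.
have [<-|ne] := eqVneq (size s) m; last first.
  rewrite (_ : [set w | history w m = s] = set0) ?setI0 ?measure0 ?mule0 //.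
  by apply/seteqP; split=> w //= h; move: ne; rewrite -h size_mkseq eqxx.
rewrite (history_law hX) -EFinM mulrC.
have -> : weight R s * step_law R p.1.+1 p.2.+1 = weight R (rcons s p).
  by rewrite /weight -cats1 big_cat big_seq1.
rewrite -(history_law hX) size_rcons; congr (P _).
apply/seteqP; split=> w /=; rewrite /history mkseqS.
  by move=> [-> ->].
by move=> /rcons_inj[].
Qed.

(** Summation over the histories in A. *)
Lemma history_increment_indep m (A : set (seq (nat * nat))) p :
  P ([set w | increment w m = p] `&` [set w | A (history w m)]) =
  ((step_law R p.1.+1 p.2.+1)%:E * P [set w | A (history w m)])%E.
Proof.
apply: fiber_product.
- exact: measurable_increment.
- by move=> s; exact: measurable_history.
- by move=> s; exact: measurable_history.
- by move=> s; exact: history_increment.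
Qed.

Lemma increment_law m p :
  P [set w | increment w m = p] = (step_law R p.1.+1 p.2.+1)%:E.
Proof.
have := history_increment_indep m setT p.
rewrite (_ : [set w | setT _] = setT); last by apply/seteqP; split.
by rewrite setIT probability_setT mule1.
Qed.

(** Summation over the increments in B. *)
Lemma increment_indep m (A : set (seq (nat * nat))) (B : set (nat * nat)) :
  P ([set w | A (history w m)] `&` [set w | B (increment w m)]) =
  (P [set w | A (history w m)] * P [set w | B (increment w m)])%E.
Proof.
have mA : measurable [set w | A (history w m)].
  by apply: measurable_fibers => s; exact: measurable_history.
have PA : P [set w | A (history w m)] \is a fin_num by exact: fin_num_measure.
rewrite -[P [set w | A (history w m)]]fineK //; apply: fiber_product => //.
- by move=> p; exact: measurable_increment.
- by move=> p; exact: measurable_increment.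
move=> p; rewrite fineK // setIC history_increment_indep increment_law.
by rewrite muleC.
Qed.

Lemma increments_indep m (B : nat -> set (nat * nat)) :
  P [set w | forall i, (i < m)%N -> B i (increment w i)] =
  (\prod_(i < m) P [set w | B i (increment w i)])%E.
Proof.
elim: m => [|m IH].
  rewrite big_ord0 (_ : mkset _ = setT) ?probability_setT //.
  by apply/seteqP; split.
rewrite big_ord_recr /= -IH.
pose A : set (seq (nat * nat)) :=
  [set s | forall i, (i < m)%N -> B i (nth (0, 0)%N s i)].
have E : [set w | forall i, (i < m)%N -> B i (increment w i)] =
    [set w | A (history w m)].
  apply/seteqP; split=> w /= H i im; first by rewrite nth_mkseq //; exact: H.
  by have := H i im; rewrite nth_mkseq.
rewrite E -increment_indep -E; congr (P _).
apply/seteqP; split=> w /=.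
  by move=> H; split=> [i im|]; apply: H => //; exact: ltnW.
by move=> [H1 H2] i; rewrite ltnS leq_eqVlt => /orP[/eqP->|/H1].
Qed.

Definition partial_sum (m : nat) (w : T) : lattice := walk (history w m).

Lemma partial_sumS m w : partial_sum m.+1 w - partial_sum m w =
  pt (increment w m).1 (increment w m).2.
Proof.
rewrite /partial_sum /history mkseqS -/(history w m) walk_rcons.
by rewrite addrC addKr.
Qed.

Lemma measurable_partial_sum m : measurable_fun setT (partial_sum m).
Proof.
move=> _ B _; rewrite setTI.
apply: (measurable_fibers [set s | B (walk s)]) => s.
exact: measurable_history.
Qed.

HB.instance Definition _ m :=
  isMeasurableFun.Build _ _ _ _ (partial_sum m) (measurable_partial_sum m).

Definition renewal_point (m : nat) : {RV P >-> lattice} := partial_sum m.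

Lemma WstarP w q : Wstar X w q <-> exists i j, q = pt i j /\ conf w i j.
Proof.
split=> [[[q' q'Q] /= Xq <-]|[i [j [-> cij]]]]; last by exists (ptQ i j).
have := q'Q; rewrite inE => -[i [j [i0 j0 e]]].
have e' : q' = pt i.-1 j.-1 by rewrite /pt !prednK.
exists i.-1, j.-1; split => //; rewrite /is_true /conf -[RHS]Xq; congr (X _ w).
by apply: val_inj; rewrite /= e'.
Qed.

(** Every partial sum is a corner, hence a point of W*. Conversely a point of W*
    that is none of the first m partial sums lies beyond the m-th one, thus in
    a row of height more than m, which fails for large m. *)
Lemma Wstar_walk w : regular w ->
  Wstar X w = [set partial_sum m w | m in [set m : nat | (0 < m)%N]].
Proof.
move=> gw.
have residualE m i j := translatesE (history w m) (conf w) i j.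
have ra m : renewal_at (translates (history w m) (conf w)).
  by have [cm _] := history_chain m gw; exact: gw.
have inc m : increment w m = first_corner (translates (history w m) (conf w)).
  by have [_ ->] := history_chain m gw; rewrite /increment asboolT.
have stepE m :
    partial_sum m.+1 w = pt (\sum_(p <- history w m) p.1.+1 + (increment w m).1)%N
     (\sum_(p <- history w m) p.2.+1 + (increment w m).2)%N.
  rewrite /partial_sum walkE /history mkseqS !big_rcons /pt.
  by congr pair; rewrite /=; lia.
apply/seteqP; split=> q; last first.
  move=> [[//|m] _ <-]; apply/WstarP; rewrite stepE.
  eexists; eexists; split; first by [].
  by rewrite -residualE inc; have /cornerP[] := first_cornerP (ra m).
move=> /WstarP[i [j [-> cij]]].
have : forall m, (exists k, (0 < k)%N /\ partial_sum k w = pt i j) \/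
    ((\sum_(p <- history w m) p.1.+1 <= i)%N /\
     (\sum_(p <- history w m) p.2.+1 <= j)%N).
  elim=> [|m [IH|[iA jB]]]; [by right; rewrite !big_nil | by left |].
  have [_ /(_ (increment w m, (i - \sum_(p <- history w m) p.1.+1,
                               j - \sum_(p <- history w m) p.2.+1)%N))] := ra m.
  rewrite /= residualE !subnKC // cij andbT inc.
  have /cornerP[_ _] := first_cornerP (ra m).
  rewrite first_cornerP //= -inc => /orP[/eqP e|/andP[h1 h2]].
    left; exists m.+1; split=> //; rewrite stepE -e /=.
    by rewrite !subnKC.
  right; rewrite /history mkseqS -/(history w m) !big_rcons /=; lia.
move=> /(_ j.+1)[[k [k0 <-]]|[_ jB]]; first by exists k.
have := leq_size_sum (history w j.+1); rewrite size_mkseq; lia.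
Qed.

Lemma partial_sum_inj w : injective (fun m => partial_sum m w).
Proof.
have mono m n : (m < n)%N -> partial_sum m w <> partial_sum n w.
  move=> mn; rewrite /partial_sum !walkE => -[_].
  have -> : history w n = history w m ++ [seq increment w i | i <- iota m (n - m)].
    by rewrite /history /mkseq -map_cat -{1}(subnKC (ltnW mn)) iotaD.
  rewrite big_cat /=; have := leq_size_sum [seq increment w i | i <- iota m (n - m)].
  rewrite size_map size_iota; lia.
by move=> m n E; case: (ltngtP m n) => // /mono; rewrite E.
Qed.

(** The mean dominates its truncations to the events that the first increment
    lies in a K x K box. *)
Lemma expectation_unbounded (h : nat * nat -> nat) :
    (forall A : R, exists K, A <=
       \sum_(p : 'I_K * 'I_K)
          (h (val p.1, val p.2))%:R * step_law R (val p.1).+1 (val p.2).+1) ->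
  'E_P[fun w => (h (increment w 0))%:R]%E = +oo%E.
Proof.
move=> H; rewrite unlock.
have m1 p : measurable [set w | increment w 0 = p] by exact: measurable_increment.
have mI p : measurable_fun setT
    ((fun w => (\1_[set w | increment w 0 = p] w)%:E) : T -> \bar R).
  exact/measurable_EFinP/measurable_indic.
have mh : measurable_fun setT ((fun w => ((h (increment w 0))%:R)%:E) : T -> \bar R).
  apply/measurable_EFinP => _ B _; rewrite setTI.
  exact: (measurable_fibers [set p | B (h p)%:R]).
apply: eq_infty => A; have [K AK] := H A.
pose f (p : 'I_K * 'I_K) (w : T) : \bar R :=
  (((h (val p.1, val p.2))%:R : R)%:E *
   (\1_[set w | increment w 0 = (val p.1, val p.2)] w : R)%:E)%E.
have mf p : measurable_fun setT (f p) by exact: measurable_funeM.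
have f0 p w : setT w -> (0 <= f p w)%E by move=> _; rewrite mule_ge0 // lee_fin.
apply: (@le_trans _ _ (\int[P]_w (\sum_(p : 'I_K * 'I_K) f p w))%E).
  rewrite ge0_integral_sum //.
  rewrite -lee_fin in AK; apply: (le_trans AK).
  rewrite -sumEFin; apply: lee_sum => p _.
  rewrite /f ge0_integralZl_EFin //.
  rewrite integral_indic // setIT EFinM le_eqVlt; apply/orP; left; apply/eqP.
  by congr (_ * _)%E; apply/esym; exact: (increment_law 0 (val p.1, val p.2)).
apply: ge0_le_integral => //.
- by move=> w _; apply: sume_ge0 => p _; exact: f0.
- exact: emeasurable_sum.
move=> w _.
have [[p wp]|Np] :=
  pselect (exists p : 'I_K * 'I_K, increment w 0 = (val p.1, val p.2)).
  rewrite (bigD1 p) //= big1 ?adde0 => [|q qp].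
    by rewrite /f indicE mem_set // mule1 wp.
  rewrite /f indicE memNset ?mule0 //= wp => -[/val_inj e1 /val_inj e2].
  by move: qp; rewrite (surjective_pairing q) -e1 -e2 -surjective_pairing eqxx.
rewrite big1 ?lee_fin // => p _; rewrite /f indicE memNset ?mule0 //= => e.
by apply: Np; exists p.
Qed.

End RandomWalk.

(** The truncated mean is K u_K (1 - u_K), with K u_K unbounded and u_K bounded
    away from 1. *)
Lemma mean_unbounded (R : realType) (A : R) : exists K, A <=
  \sum_(p : 'I_K * 'I_K) (val p.1).+1%:R * step_law R (val p.1).+1 (val p.2).+1.
Proof.
have [K K0 AK] := @central_unbounded R (`|A| * 3); exists K.
rewrite sum_step_law_mean.
have := central_sqr_le R K; have := central_gt0 R K.
have K1 : 1 <= K%:R :> R by rewrite ler1n.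
move=> c0 c1.
have c2 : 3 * central R K ^+ 2 <= 1.
  apply: le_trans c1; apply: ler_wpM2r; [exact: sqr_ge0 | lra].
have c3 : 3^-1 <= 1 - central R K by nra.
apply: (le_trans (ler_norm A)).
rewrite -[leLHS](mulfK (_ : 3 != 0)) //; apply: ler_pM => //; lra.
Qed.

Lemma mean_unbounded_snd (R : realType) (A : R) : exists K, A <=
  \sum_(p : 'I_K * 'I_K) (val p.2).+1%:R * step_law R (val p.1).+1 (val p.2).+1.
Proof.
have [K AK] := mean_unbounded A; exists K; apply: le_trans AK _.
rewrite -(pair_bigA _ (fun i j : 'I_K => i.+1%:R * step_law R i.+1 j.+1)) /=.
rewrite exchange_big pair_big /= le_eqVlt; apply/orP; left; apply/eqP.
by apply: eq_bigr => p _; rewrite step_law_sym.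
Qed.

Lemma prod_fset_positive (R : realType) (J : {fset nat}) (F : nat -> \bar R)
    (n : nat) :
  (forall i, i \in J -> (0 < i <= n)%N) ->
  (\prod_(i <- J) F i = \prod_(i < n) (if i.+1 \in J then F i.+1 else 1))%E.
Proof.
move=> Jn; rewrite -big_mkcond /=.
transitivity (\prod_(i <- [seq i.+1 | i <- iota 0 n & i.+1 \in J]) F i)%E; last first.
  rewrite big_map big_filter.
  by rewrite -(big_mkord (fun i => i.+1 \in J) (fun i => F i.+1)) /index_iota subn0.
apply: perm_big; apply: uniq_perm.
- exact: fset_uniq.
- by rewrite (map_inj_uniq succn_inj) filter_uniq // iota_uniq.
move=> i; apply/idP/mapP => [iJ|[j]].
  have /andP[i0 iN] := Jn i iJ.
  by exists i.-1; rewrite ?prednK // mem_filter prednK // iJ mem_iota; lia.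
by rewrite mem_filter => /andP[jJ _ ->].
Qed.

Lemma partial_sums_indep (R : realType) (d : measure_display)
    (T : measurableType d) (P : probability T R) (X : Q -> {RV P >-> bool}) :
  limit_of_XN X ->
  mutually_independent P [set m : nat | (0 < m)%N]
    (fun m w => renewal_point X m w - renewal_point X m.-1 w).
Proof.
move=> hX J B J0 mB.
pose n := \max_(i <- J) i.
have Jn i : i \in J -> (0 < i <= n)%N.
  by move=> iJ; rewrite (J0 i iJ) /=; apply: leq_bigmax_seq.
rewrite (prod_fset_positive _ Jn).
pose B' i : set (nat * nat) := [set p | i.+1 \in J -> B i.+1 (pt p.1 p.2)].
have -> : \bigcap_(i in [set` J])
      ((fun w => renewal_point X i w - renewal_point X i.-1 w) @^-1` B i) =
    [set w | forall i, (i < n)%N -> B' i (increment X w i)].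
  apply/seteqP; split=> w /= H i.
    by move=> _ iJ; have := H _ iJ; rewrite /= partial_sumS.
  move=> iJ; have /andP[i0 iN] := Jn i iJ.
  have : (i.-1 < n)%N by rewrite prednK.
  by move=> /H; rewrite /B' /= prednK // => /(_ iJ); rewrite -partial_sumS prednK.
rewrite increments_indep //; apply: eq_bigr => i _.
case: ifPn => iJ.
  congr (P _); apply/seteqP; split=> w; rewrite /B' /= partial_sumS //.
  by apply.
rewrite (_ : mkset _ = setT) ?probability_setT //.
by apply/seteqP; split=> w // _ /= iJ'; rewrite iJ' in iJ.
Qed.

Theorem theorem2p19 (R : realType) (d : measure_display) (T : measurableType d)
    (P : probability T R) (X : Q -> {RV P >-> bool}) (hX : limit_of_XN X) :
  exists V : nat -> {RV P >-> lattice},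
    [/\ {ae P, forall w, infinite_set (Wstar X w) /\
            Wstar X w = [set V m w | m in [set m : nat | (0 < m)%N]]},
        forall w, V 0%N w = (0, 0),
        forall (m : nat) w, (0 < m)%N -> Q (V m w - V m.-1 w),
        mutually_independent P [set m : nat | (0 < m)%N]
          (fun m w => V m w - V m.-1 w)
      & forall m a b : nat, (0 < m)%N -> (0 < a)%N -> (0 < b)%N ->
          P [set w | V m w - V m.-1 w = (- a%:Z, b%:Z)] = (step_law R a b)%:E]
    /\ 'E_P[fun w => `|(V 1%N w).1|%:~R]%E = +oo%E
    /\ 'E_P[fun w => `|(V 1%N w).2|%:~R]%E = +oo%E.
Proof.
exists (renewal_point X).
have V1 w : renewal_point X 1 w = pt (increment X w 0).1 (increment X w 0).2.
  by rewrite /= /partial_sum /history /mkseq /= /walk big_seq1.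
split; [split | split].
- apply: negligibleS (irregular_null hX) => w /= H gw; apply: H.
  rewrite Wstar_walk //; split => // fin.
  apply: infinite_nat.
  have inj : {in [set: nat] &, injective (fun m => renewal_point X m.+1 w)}.
    by move=> m n _ _ /partial_sum_inj[].
  rewrite -(eq_finite_set (inj_card_eq inj)); apply: sub_finite_set fin.
  by move=> _ [m _ <-]; exists m.+1.
- by move=> w; rewrite /= /partial_sum /history /mkseq /= /walk big_nil.
- move=> [//|m] w _; rewrite /= partial_sumS; exact: pt_Q.
- exact: partial_sums_indep.
- move=> [//|m] [//|a] [//|b] _ _ _ /=.
  rewrite -(increment_law hX m (a, b)); congr (P _).
  apply/seteqP; split=> w /=; rewrite partial_sumS.
    by case: (increment X w m) => i j [h1 h2]; congr pair; lia.
  by move=> ->.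
- rewrite -(expectation_unbounded hX (h := fun p => p.1.+1) (@mean_unbounded R)).
  by congr ('E_P[_])%E; apply/funext => w; rewrite V1 /= normrN.
rewrite -(expectation_unbounded hX (h := fun p => p.2.+1) (@mean_unbounded_snd R)).
by congr ('E_P[_])%E; apply/funext => w; rewrite V1.
Qed.
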